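(* Let $R$ be a finite chain ring with maximal ideal $\mathfrak{m}$, let $q=|R/\mathfrak{m}|$, and let $S=R[x]/(h)$, where $h\in R[x]$ is monic of degree $m$ and irreducible modulo $\mathfrak{m}$. Let $\sigma$ be a generator of the Galois group of $R\subseteq S$ as described in the context. Let $n_1,\ldots,n_\ell$ be positive integers and $n=n_1+\cdots+n_\ell$. Let $\mathbf{a}=(a_1,\ldots,a_\ell)\in(S^* )^\ell$ and $\boldsymbol\beta=(\boldsymbol\beta_1,\ldots,\boldsymbol\beta_\ell)$ with $\boldsymbol\beta_i=(\beta_{i,1},\ldots,\beta_{i,n_i})\in S^{n_i}$, and assume that (i) $a_i-a_j^{\beta}\in S^*$ for all $\beta\in S^*$ and all $1\le i<j\le \ell$, and (ii) for each $i$, the elements $\beta_{i,1},\ldots,\beta_{i,n_i}$ are linearly independent over $R$. For $k\in\{1,\ldots,n\}$, let $\mathcal{C}_k(\mathbf{a},\boldsymbol\beta)\subseteq S^n$ be the $S$-submodule of $S^n$ generated by the rows of the $k\times n$ matrix $M_k(\mathbf{a},\boldsymbol\beta)$ whose row $s$ ($s=0,1,\ldots,k-1$) is $$\big(\mathcal{D}_{a_1}^s(\beta_{1,1}),\ldots,\mathcal{D}_{a_1}^s(\beta_{1,n_1}),\ldots,\mathcal{D}_{a_\ell}^s(\beta_{\ell,1}),\ldots,\mathcal{D}_{a_\ell}^s(\beta_{\ell,n_\ell})\big).$$ Then $\mathcal{C}_k(\mathbf{a},\boldsymbol\beta)$ is a free $S$-module of rank $k$ and is a maximum sum-rank distance (MSRD)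 code over $R$ for the length partition $n=n_1+\cdots+n_\ell$.
   Context: $R$ is a finite commutative chain ring (a finite local ring whose ideals are totally ordered by inclusion), with maximal ideal $\mathfrak{m}$ and residue field $\mathbb{F}_q=R/\mathfrak{m}$. $S=R[x]/(h)$ is a free local Galois extension of $R$ of rank $m$ with maximal ideal $\mathfrak{M}=\mathfrak{m}S$ and $S/\mathfrak{M}=\mathbb{F}_{q^m}$; $S^*=S\setminus\mathfrak{M}$ is its unit group. $\sigma:S\to S$ is a ring automorphism generating the (cyclic, order $m$) Galois group of $R\subseteq S$, with fixed ring $R$, and reducing modulo $\mathfrak{M}$ to the Frobenius $y\mapsto y^q$ of $\mathbb{F}_{q^m}$. For $a\in S$ and $i\in\mathbb{N}$, $N_i(a)=\sigma^{i-1}(a)\cdots\sigma(a)a$ (with $N_0(a)=1$) and $\mathcal{D}_a^i(\beta)=\sigma^i(\beta)N_i(a)$ for $\beta\in S$ (so $\mathcal{D}_a^0$ is the identity). For $a\in S$, $\beta\in S^*$, $a^\beta=\sigma(\beta)a\beta^{-1}$. Rank: for $\mathbf{u}\in S^t$, fix an $R$-basis $\alpha_1,\ldots,\alpha_m$ of $S$ and write $\mathbf{u}=\sum_{i=1}^m\alpha_i(c_{i,1},\ldots,c_{i,t})$ with $c_{i,j}\in R$; ${\rm rk}(\mathbf{u})$ is the number of nonzero diagonal entries of the Smith normal form of the $m\times t$ matrix $(c_{i,j})$ over $R$ (independent of the basis). For $\mathbf{c}=(\mathbf{c}^{(1)},\ldots,\mathbf{c}^{(\ell)})\in S^n$ with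 $\mathbf{c}^{(i)}\in S^{n_i}$, the sum-rank weight is ${\rm wt}_{SR}(\mathbf{c})=\sum_i{\rm rk}(\mathbf{c}^{(i)})$, the sum-rank distance is ${\rm d}_{SR}(\mathbf{c},\mathbf{d})={\rm wt}_{SR}(\mathbf{c}-\mathbf{d})$, and ${\rm d}_{SR}(\mathcal{C})$ is the minimum distance between distinct codewords. A code $\mathcal{C}\subseteq S^n$ is MSRD (over $R$, for this partition) if $k=\log_{|S|}|\mathcal{C}|$ is a positive integer and ${\rm d}_{SR}(\mathcal{C})=n-k+1$. *)

(* Defs.v *)
From HB Require Import structures.
From mathcomp Require Import all_boot all_order all_algebra.
Set Implicit Arguments. Unset Strict Implicit. Unset Printing Implicit Defensive.
Import Order.TTheory GRing.Theory.
Local Open Scope ring_scope.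

Definition is_ideal (R : comNzRingType) (I : {pred R}) : Prop :=
  0 \in I /\ (forall x y, x \in I -> y \in I -> x + y \in I) /\
  (forall r x, x \in I -> r * x \in I).

Definition is_chain_ring (R : finComUnitRingType) : Prop :=
  is_ideal [pred r : R | r \notin GRing.unit] /\
  (forall I J : {set R}, is_ideal (mem I) -> is_ideal (mem J) ->
      I \subset J \/ J \subset I).

(* q = |R / m|, m the maximal ideal (= non-units) *)
Definition residue_card (R : finComUnitRingType) : nat :=
  #|[set: R]| %/ #|[set r : R | r \notin GRing.unit]|.

Definition irreducible_mod_max (R : finComUnitRingType) (h : {poly R}) : Prop :=
  forall f g : {poly R},
    (forall i, (h - f * g)`_i \notin GRing.unit) ->
    (forall i, (0 < i)%N -> f`_i \notin GRing.unit) \/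
    (forall i, (0 < i)%N -> g`_i \notin GRing.unit).

Section Rank.
Variable R : finComUnitRingType.

Definition is_snf m t (D : 'M[R]_(m, t)) : bool :=
  [forall i : 'I_m, forall j : 'I_t, (i != j :> nat) ==> (D i j == 0)] &&
  [forall i : 'I_m, forall j : 'I_m, forall i' : 'I_t, forall j' : 'I_t,
     [&& (i == i' :> nat), (j == j' :> nat) & (i <= j)%N] ==>
     [exists c : R, D j j' == c * D i i']].

Definition diag_nz m t (D : 'M[R]_(m, t)) : nat :=
  #|[set i : 'I_m | [exists j : 'I_t, (i == j :> nat) && (D i j != 0)]]|.

Definition snf_count m t (A : 'M[R]_(m, t)) (r : nat) : bool :=
  [exists P : 'M[R]_m, exists Q : 'M[R]_t, exists D : 'M[R]_(m, t),
     [&& P \in unitmx, Q \in unitmx, A == P *m D *m Q, is_snf D &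
         diag_nz D == r]].

Definition mxrk m t (A : 'M[R]_(m, t)) : nat :=
  \big[minn/minn m t]_(r < (minn m t).+1 | snf_count A r) r.
End Rank.

Section SumRank.
Variables (R : finComUnitRingType) (S : finComUnitRingType).
Variables (iota : R -> S) (x : S) (m : nat).
(* the R-basis 1, x, ..., x^(m-1) of S = R[x]/(h) is used for coordinates *)

Definition rk t (u : 'I_t -> S) : nat :=
  \big[minn/m]_(C : 'M[R]_(m, t) |
      [forall j, u j == \sum_(i < m) iota (C i j) * x ^+ i]) mxrk C.

Variables (l : nat) (nn : 'I_l -> nat).
Definition idx := {i : 'I_l & 'I_(nn i)}.
Definition block (c : {ffun idx -> S}) (i : 'I_l) : 'I_(nn i) -> S :=
  fun j => c (Tagged (fun i0 : 'I_l => 'I_(nn i0)) j).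

Definition wtSR (c : {ffun idx -> S}) : nat := \sum_(i < l) rk (@block c i).
Definition dist_SR (c d : {ffun idx -> S}) : nat :=
  wtSR [ffun p => c p - d p].
Definition ntot : nat := \sum_(i < l) nn i.
Definition dSR (C : {set {ffun idx -> S}}) : nat :=
  \big[minn/ntot]_(c in C) \big[minn/ntot]_(d in C | c != d) dist_SR c d.

Definition is_MSRD (C : {set {ffun idx -> S}}) : Prop :=
  exists k : nat, (0 < k)%N /\ #|C| = (#|[set: S]| ^ k)%N /\
     dSR C = (ntot - k + 1)%N.
End SumRank.

Definition Nop (S : comNzRingType) (sigma : S -> S) (i : nat) (a : S) : S :=
  \prod_(j < i) iter j sigma a.
Definition Dop (S : comNzRingType) (sigma : S -> S) (a : S) (i : nat) (b : S) : S :=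
  iter i sigma b * Nop sigma i a.

Definition free_of_rank (S : finComUnitRingType) (T : finType) (C : {set {ffun T -> S}})
  (k : nat) : Prop :=
  exists b : 'I_k -> {ffun T -> S},
    (forall s, b s \in C) /\
    (forall c, c \in C -> exists lam : 'I_k -> S,
        c = [ffun p => \sum_(s < k) lam s * b s p]) /\
    (forall lam : 'I_k -> S,
        [ffun p => \sum_(s < k) lam s * b s p] = [ffun => 0] ->
        forall s, lam s = 0).

Definition code_Ck (S : finComUnitRingType) (sigma : S -> S) (l : nat)
  (nn : 'I_l -> nat) (a : 'I_l -> S) (beta : forall i : 'I_l, 'I_(nn i) -> S)
  (k : nat) : {set {ffun idx nn -> S}} :=
  [set c | [exists lam : {ffun 'I_k -> S},
     c == [ffun p : idx nn => \sum_(s < k)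
              lam s * Dop sigma (a (tag p)) s (beta (tag p) (tagged p))]]].

(* Main.v *)
(* Let M be the set of nonunits of S, and let rho span the socle of R. In
   coordinates over R, Euclid's algorithm against h modulo the maximal ideal shows
   that an element with a unit coordinate is a unit; hence s lies in M iff
   rho * s = 0. Multiplying by suitable elements of R therefore turns exact linear
   independence and exact roots into statements modulo M.
   Modulo M, a skew polynomial with k coefficients vanishing at k blockwise
   independent points has all coefficients in M: dividing on the right by X - b,
   where b is the conjugate of a_i at one of the points, leaves k - 1 coefficients
   and k - 1 points, still independent because the a_i are pairwise non-conjugate
   and the residues fixed by sigma come from R.
   If the Smith form of a block of a codeword has r nonzero entries, an invertible
   change of that block over R produces at least n_i - r zeros, i.e. roots of the
   same skew polynomial at independent points; so a nonzero codeword has weight at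
   least n - k + 1. Two codewords that agree at k - 1 positions attain the bound,
   since the rank of a block is at most its number of nonzero entries. *)
Require Import Defs.
From HB Require Import structures.
From mathcomp Require Import all_boot all_order all_algebra.
From mathcomp Require Import fingroup morphism perm quotient cyclic ring.
Set Implicit Arguments. Unset Strict Implicit. Unset Printing Implicit Defensive.
Import GRing.Theory Pdiv.Ring.
Local Open Scope ring_scope.

(** * Chain rings *)

Lemma nonunitMl (R : comUnitRingType) (x y : R) :
  y \isn't a GRing.unit -> x * y \isn't a GRing.unit.
Proof. by rewrite unitrM negb_and orbC => ->. Qed.

Lemma nonunitMr (R : comUnitRingType) (x y : R) :
  x \isn't a GRing.unit -> x * y \isn't a GRing.unit.
Proof. by rewrite mulrC; apply: nonunitMl. Qed.

Lemma nonunit0 (R : unitRingType) : (0 : R) \isn't a GRing.unit.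
Proof. by rewrite unitr0. Qed.

(** In a finite ring an injective multiplication is onto, so it reaches 1. *)
Lemma unit_of_lreg (R : finComUnitRingType) (s : R) :
  (forall y, s * y = 0 -> y = 0) -> s \is a GRing.unit.
Proof.
move=> s0; have inj : injective (fun y => s * y).
  by move=> y z /= e; apply/eqP; rewrite -subr_eq0; apply/eqP/s0; rewrite mulrBr e subrr.
have /imageP[y _ e] : 1 \in codom (fun y => s * y) by apply: injF_onto.
by apply/unitrPr; exists y.
Qed.

Section ChainRing.
Variable R : finComUnitRingType.
Hypothesis chainR : is_chain_ring R.

Lemma chain_nonunitD (x y : R) :
  x \isn't a GRing.unit -> y \isn't a GRing.unit -> x + y \isn't a GRing.unit.
Proof. by case: chainR => [[_ [+ _]] _] => /(_ x y); rewrite !inE. Qed.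

Lemma chain_unit1B (x : R) : x \isn't a GRing.unit -> 1 - x \is a GRing.unit.
Proof.
move=> nx; apply/negPn/negP => /chain_nonunitD /(_ nx).
by rewrite subrK unitr1.
Qed.

Let princ (x : R) := [set c * x | c : R].

Let princ_ideal x : is_ideal (mem (princ x)).
Proof.
split; first by apply/imsetP; exists 0; rewrite ?mul0r.
split=> [_ _ /imsetP[c _ ->] /imsetP[d _ ->]|r _ /imsetP[c _ ->]].
  by apply/imsetP; exists (c + d); rewrite ?mulrDl.
by apply/imsetP; exists (r * c); rewrite ?mulrA.
Qed.

Lemma chain_dvd_total (x y : R) : (exists c, x = c * y) \/ (exists c, y = c * x).
Proof.
have mem1 z : z \in princ z by apply/imsetP; exists 1; rewrite ?mul1r.
have [_ /(_ _ _ (princ_ideal x) (princ_ideal y))] := chainR.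
case=> /subsetP sub; [left | right].
  by have /imsetP[c _ ->] := sub _ (mem1 x); exists c.
by have /imsetP[c _ ->] := sub _ (mem1 y); exists c.
Qed.

(** Take a value whose principal ideal has maximal cardinality: since divisibility is total, this
    ideal contains all the other values. *)
Lemma chain_common_divisor (I : finType) (f : I -> R) (i0 : I) :
  exists i, forall j, exists c, f j = c * f i.
Proof.
case: (@arg_maxnP _ i0 xpredT (fun i => #|princ (f i)|)) => // i _ imax.
exists i => j; case: (chain_dvd_total (f j) (f i)) => // -[c e].
have sub : princ (f i) \subset princ (f j).
  by apply/subsetP=> _ /imsetP[d _ ->]; apply/imsetP; exists (d * c); rewrite // e mulrA.
have /eqP eqij : princ (f i) == princ (f j).
  by rewrite eqEcard sub; apply: imax.
have /imsetP[d _ ->] : f j \in princ (f i); last by exists d.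
by rewrite eqij; apply/imsetP; exists 1; rewrite ?mul1r.
Qed.

(** [rho] generates a nonzero principal ideal of least cardinality, which by totality lies in every
    nonzero principal ideal. *)
Lemma chain_socle : exists rho : R, [/\ rho != 0,
  forall z, z \isn't a GRing.unit -> rho * z = 0
  & forall r, r != 0 -> exists c, rho = c * r].
Proof.
case: (@arg_minnP _ 1 (fun r : R => r != 0) (fun r => #|princ r|)); first exact: oner_neq0.
move=> rho rho0 rmin.
have dvd r : r != 0 -> exists c, rho = c * r.
  move=> r0; case: (chain_dvd_total rho r) => // -[c e].
  have sub : princ r \subset princ rho.
    by apply/subsetP=> _ /imsetP[d _ ->]; apply/imsetP; exists (d * c); rewrite // e mulrA.
  have /eqP eqr : princ r == princ rho by rewrite eqEcard sub; apply: rmin.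
  have /imsetP[d _ ->] : rho \in princ r; last by exists d.
  by rewrite eqr; apply/imsetP; exists 1; rewrite ?mul1r.
(* A nonzero [rho * z] would divide [rho], giving [rho * (1 - c * z) = 0] with a unit as second
   factor. *)
exists rho; split=> // z nz; apply/eqP/negPn/negP => /dvd[c e].
have u1 : 1 - c * z \is a GRing.unit by apply: chain_unit1B; apply: nonunitMl.
case/eqP: rho0; apply: (mulIr u1); rewrite mul0r mulrBr mulr1.
by rewrite {1}e mulrCA subrr.
Qed.

(* Lagrange in the additive group of the residue field *)
Lemma residue_card_nonunit : (residue_card R)%:R \isn't a (@GRing.unit R).
Proof.
pose M := [set r : R | r \notin GRing.unit].
have gM : group_set M.
  apply/group_setP; split; first by rewrite inE unitr0.
  by move=> x y; rewrite !inE; apply: chain_nonunitD.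
pose G := [set: R]%G; pose N := Group gM.
have nN : (N <| G)%g.
  rewrite -sub_abelian_normal ?subsetT //.
  by apply/centsP => x _ y _; apply: addrC.
have -> : residue_card R = #|(G / N)%g|.
  by rewrite card_quotient ?normal_norm // -divgS ?subsetT.
pose one : R := 1.
have G1 : one \in G by rewrite inE.
have nN1 : one \in 'N(N)%g by apply: (subsetP (normal_norm nN)).
have : (one ^+ #|G / N|)%g \in N.
  rewrite coset_idr ?groupX // morphX // expg_cardG //.
  exact: mem_quotient.
by rewrite FinRing.zmodXgE inE.
Qed.

End ChainRing.

(** * Smith normal form over a chain ring *)

Section SmithForm.
Variable R : finComUnitRingType.

Lemma is_snfP m t (D : 'M[R]_(m, t)) :
  reflect ((forall (i : 'I_m) (j : 'I_t), i != j :> nat -> D i j = 0) /\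
    (forall (i j : 'I_m) (i' j' : 'I_t), i = i' :> nat -> j = j' :> nat ->
       (i <= j)%N -> exists c, D j j' = c * D i i'))
  (is_snf D).
Proof.
apply: (iffP andP) => -[diag dvd]; split.
- by move=> i j nij; move: diag => /forallP/(_ i)/forallP/(_ j)/implyP/(_ nij)/eqP.
- move=> i j i' j' ei ej le_ij.
  have := forallP (forallP (forallP (forallP dvd i) j) i') j'.
  by rewrite ei ej !eqxx -ei -ej le_ij => /existsP[c /eqP]; exists c.
- by apply/forallP=> i; apply/forallP=> j; apply/implyP=> /diag ->.
- apply/forallP=> i; apply/forallP=> j; apply/forallP=> i'; apply/forallP=> j'.
  apply/implyP=> /and3P[/eqP ei /eqP ej le_ij]; apply/existsP.
  by have [c ->] := dvd _ _ _ _ ei ej le_ij; exists c.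
Qed.

Definition nz_cols m t (A : 'M[R]_(m, t)) : {set 'I_t} := [set j | col j A != 0].

Lemma nz_colsP m t (A : 'M[R]_(m, t)) j :
  reflect (exists i, A i j != 0) (j \in nz_cols A).
Proof.
rewrite inE; apply: (iffP idP) => [nz|[i nz]].
  apply/existsP; apply: contraNT nz => /existsPn z.
  by apply/eqP/colP => i; rewrite !mxE; apply/eqP/negPn/z.
by apply: contraNneq nz => /colP/(_ i); rewrite !mxE => ->.
Qed.

(** Since [mxrk] is a minimum over Smith forms, a single form with few diagonal entries bounds it;
    the last clause carries such a bound through the reduction. *)
Let has_snf m t (A : 'M[R]_(m, t)) := exists P Q D,
  [/\ P \in unitmx, Q \in unitmx, A = P *m D *m Q, is_snf D &
      (diag_nz D <= #|nz_cols A|)%N].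

Lemma is_snf0 m t : is_snf (0 : 'M[R]_(m, t)).
Proof.
by apply/is_snfP; split=> *; rewrite ?mxE //; exists 0; rewrite mul0r.
Qed.

Lemma diag_nz0 m t : diag_nz (0 : 'M[R]_(m, t)) = 0%N.
Proof.
apply/eqP; rewrite cards_eq0; apply/eqP/setP => i; rewrite !inE.
apply/negbTE/existsPn => j. by rewrite mxE eqxx andbF.
Qed.

Let has_snf0 m t : has_snf (0 : 'M_(m, t)).
Proof.
exists 1%:M, 1%:M, 0; split; rewrite ?unitmx1 ?is_snf0 ?diag_nz0 //.
by rewrite mulmx0 mul0mx.
Qed.

Let has_snf_xrow m t (A : 'M_(m, t)) i1 i2 : has_snf (xrow i1 i2 A) -> has_snf A.
Proof.
case=> P [Q [D [uP uQ eA snfD leD]]].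
exists (tperm_mx i1 i2 *m P), Q, D; split=> //.
- by rewrite unitmx_mul unitmx_perm.
- by rewrite -!mulmxA (mulmxA P) -eA xrowE mulmxA -perm_mxM tperm2 perm_mx1 mul1mx.
rewrite (leq_trans leD) //; apply/subset_leq_card/subsetP => j /nz_colsP[i].
by rewrite mxE => nz; apply/nz_colsP; exists (tperm i1 i2 i).
Qed.

Let has_snf_xcol m t (A : 'M_(m, t)) j1 j2 : has_snf (xcol j1 j2 A) -> has_snf A.
Proof.
case=> P [Q [D [uP uQ eA snfD leD]]].
exists P, (Q *m tperm_mx j1 j2), D; split=> //.
- by rewrite unitmx_mul uQ unitmx_perm.
- by rewrite mulmxA -eA xcolE -mulmxA -perm_mxM tperm2 perm_mx1 mulmx1.
rewrite (leq_trans leD) //.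
rewrite -(card_imset (mem (nz_cols (xcol j1 j2 A))) (@perm_inj _ (tperm j1 j2))).
apply/subset_leq_card/subsetP => _ /imsetP[j /nz_colsP[i nz] ->].
by rewrite mxE in nz; apply/nz_colsP; exists i.
Qed.

(** Block elimination with the Schur complement [E2] of the corner. The induction hypothesis is
    applied to [a *: E2], so that the rest of the diagonal stays divisible by the pivot [a]. *)
Let has_snf_pivot m t (a : R) (E : 'M_(1 + m, 1 + t)) :
  a != 0 -> E 0 0 = 1 -> (forall B : 'M_(m, t), has_snf B) -> has_snf (a *: E).
Proof.
move=> a0 E00 IH; pose El := dlsubmx E; pose Eu := ursubmx E.
pose E2 := drsubmx E - El *m Eu.
have [P [Q [D [uP uQ eA snfD leD]]]] := IH (a *: E2).
have ulE : ulsubmx E = 1%:M.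
  by rewrite [LHS]mx11_scalar !mxE !lshift0 E00.
have dvdD : exists F, D = a *: F.
  exists (invmx P *m E2 *m invmx Q).
  by rewrite scalemxAl scalemxAr eA -mulmxA mulKmx // mulmxK.
exists (block_mx 1%:M 0 El P), (block_mx 1%:M Eu 0 Q), (block_mx a%:M 0 0 D); split.
- by rewrite unitmxE det_lblock det1 mul1r.
- by rewrite unitmxE det_ublock det1 mul1r.
- rewrite !mulmx_block !(mul0mx, mulmx0, addr0, mulmx1, mul1mx, add0r).
  rewrite -eA mul_mx_scalar mul_scalar_mx -scalemxAl -scalerDr addrC subrK.
  by rewrite -[a%:M]scalemx1 -ulE -scale_block_mx submxK.
- have [diag dvd] := is_snfP _ snfD; apply/is_snfP; split=> [i j|i j i' j'].
    case: (split_ordP i) => i1 ->; case: (split_ordP j) => j1 ->.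
    + by rewrite !ord1 /=.
    + by rewrite block_mxEur mxE.
    + by rewrite block_mxEdl mxE.
    + by rewrite block_mxEdr /= eqn_add2l; apply: diag.
  case: (split_ordP i) => i1 ->; case: (split_ordP i') => i'1 -> //=; rewrite ?ord1 //.
    have ulD : (block_mx a%:M 0 0 D : 'M_(1 + m, 1 + t)) (lshift m 0) (lshift t 0) = a.
      by rewrite block_mxEul mxE eqxx mulr1n.
    move=> _; rewrite ulD.
    case: (split_ordP j) => j1 ->; case: (split_ordP j') => j'1 -> //=;
      rewrite ?ord1 // => _ _.
      by exists 1; rewrite ulD mul1r.
    by have [F ->] := dvdD; exists (F j1 j'1); rewrite block_mxEdr mxE mulrC.
  case=> ei; case: (split_ordP j) => j1 ->; case: (split_ordP j') => j'1 -> //=;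
    rewrite ?ord1 //.
  case=> ej; rewrite ltnS !block_mxEdr; exact: dvd.
- have le1 : (diag_nz (block_mx a%:M 0 0 D : 'M_(1 + m, 1 + t)) <= 1 + diag_nz D)%N.
    pose Y := [set i : 'I_m | [exists j : 'I_t, (i == j :> nat) && (D i j != 0)]].
    pose X := [set rshift 1 i | i in Y].
    have -> : diag_nz D = #|X| by rewrite card_imset //; apply: rshift_inj.
    apply: (@leq_trans #|lshift m 0 |: X|); last first.
      by rewrite cardsU1 leq_add2r leq_b1.
    apply/subset_leq_card/subsetP => i; rewrite inE => /existsP[j /andP[/eqP eij nz]].
    case: (split_ordP i) eij nz => i1 ->; first by rewrite ord1 setU11.
    case: (split_ordP j) => j1 -> //=; first by rewrite ord1.
    rewrite block_mxEdr => /addnI e nz; apply/setU1P; right; apply: imset_f.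
    by rewrite inE; apply/existsP; exists j1; rewrite e eqxx.
  apply: leq_trans le1 (leq_trans _ (_ : 1 + #|nz_cols (a *: E2)| <= _)%N).
    by rewrite leq_add2l.
  pose X := [set rshift 1 j | j in nz_cols (a *: E2)].
  have -> : #|nz_cols (a *: E2)| = #|X| by rewrite card_imset //; apply: rshift_inj.
  have <- : #|lshift t 0 |: X| = (1 + #|X|)%N.
    rewrite cardsU1; congr (_ + _)%N; case: imsetP => //= -[j _ /eqP].
    by rewrite eq_lrshift.
  apply/subset_leq_card/subsetP => j; rewrite in_setU1 => /orP[/eqP->|/imsetP[j1 + ->]].
    apply/nz_colsP; exists (lshift m 0).
    by rewrite mxE !lshift0 E00 mulr1.
  (* If a column of [a *: E] vanishes, so does the matching column of [a *: E2]: each of its terms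
     has a factor from that column. *)
  rewrite !inE; apply: contraNneq => /colP z; apply/eqP/colP => i.
  have zE i' : a * E i' (rshift 1 j1) = 0 by have := z i'; rewrite !mxE.
  rewrite !mxE mulrBr zE sub0r mulr_sumr big1 ?oppr0 // => p _.
  by rewrite !mxE mulrCA zE mulr0.
Qed.

Lemma chain_snf m t (A : 'M[R]_(m, t)) : is_chain_ring R -> has_snf A.
Proof.
move=> chainR; elim: m t A => [|m IH] [|t] A.
- by rewrite [A]flatmx0.
- by rewrite [A]flatmx0.
- by rewrite [A]thinmx0.
have [[i j] /= dvd] :=
  chain_common_divisor chainR (fun p : 'I_m.+1 * 'I_t.+1 => A p.1 p.2) (0, 0).
have [z|nz] := eqVneq (A i j) 0.
  suff -> : A = 0 by [].
  by apply/matrixP => i' j'; have [c ->] := dvd (i', j'); rewrite z mulr0 mxE.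
apply: (@has_snf_xrow _ _ _ i 0); apply: (@has_snf_xcol _ _ _ j 0).
set B := xcol _ _ _.
have B00 : B 0 0 = A i j by rewrite !mxE !tpermR.
have dvdB p : exists c, B p.1 p.2 = c * A i j.
  by rewrite !mxE; apply: (dvd (tperm i 0 p.1, tperm j 0 p.2)).
have [e eB] := fin_all_exists dvdB.
(* The corner is set to 1 by hand, because the quotients in [e] are determined only up to the
   annihilator of [A i j]. *)
pose E : 'M_(1 + m, 1 + t) :=
  \matrix_(i', j') if (i' == 0) && (j' == 0) then 1 else e (i', j').
have -> : B = A i j *: E.
  apply/matrixP => i' j'; rewrite [RHS]mxE [E _ _]mxE.
  case: ifP => [/andP[/eqP-> /eqP->]|_]; first by rewrite B00 mulr1.
  by rewrite (eB (i', j')) mulrC.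
by apply: has_snf_pivot => //; rewrite mxE.
Qed.

End SmithForm.

(** * Roots of skew polynomials modulo the maximal ideal *)

Lemma Nop_recl (S : comNzRingType) (sigma : {rmorphism S -> S}) i a :
  Nop sigma i.+1 a = sigma (Nop sigma i a) * a.
Proof. by rewrite /Nop big_ord_recl mulrC rmorph_prod. Qed.

Section SkewEval.
Variables (S : comNzRingType) (sigma : {rmorphism S -> S}) (a : S).

(** [Dop sigma a i] is the i-th iterate of the map sending [y] to [sigma y * a]; here the innermost
    application is split off. *)
Lemma DopS i y : Dop sigma a i.+1 y = Dop sigma a i (sigma y * a).
Proof.
rewrite /Dop; elim: i y => [|i IH] y.
  by rewrite /Nop big_ord1 big_ord0 /= mulr1.
by rewrite Nop_recl iterS mulrA -rmorphM IH rmorphM -mulrA -Nop_recl.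
Qed.

Lemma Dop0 y : Dop sigma a 0 y = y.
Proof. by rewrite /Dop /Nop big_ord0 mulr1. Qed.

Lemma iter_rmorphM i (y z : S) : iter i sigma (y * z) = iter i sigma y * iter i sigma z.
Proof. by elim: i => //= i ->; rewrite rmorphM. Qed.

Lemma iter_rmorphD i (y z : S) : iter i sigma (y + z) = iter i sigma y + iter i sigma z.
Proof. by elim: i => //= i ->; rewrite rmorphD. Qed.

Lemma DopM i y z : Dop sigma a i (y * z) = iter i sigma y * Dop sigma a i z.
Proof. by rewrite /Dop iter_rmorphM mulrA. Qed.

Lemma DopD i y z : Dop sigma a i (y + z) = Dop sigma a i y + Dop sigma a i z.
Proof. by rewrite /Dop iter_rmorphD mulrDl. Qed.

Lemma DopB i y z : Dop sigma a i (y - z) = Dop sigma a i y - Dop sigma a i z.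
Proof. by apply/eqP; rewrite eq_sym subr_eq -DopD subrK. Qed.

Lemma Dop_zero i : Dop sigma a i 0 = 0.
Proof. by rewrite -(subrr 0) DopB !subrr. Qed.

Lemma Dop_sum i (J : Type) (r : seq J) (P : pred J) (F : J -> S) :
  Dop sigma a i (\sum_(j <- r | P j) F j) = \sum_(j <- r | P j) Dop sigma a i (F j).
Proof. exact: (big_morph _ (DopD i) (Dop_zero i)).
Qed.

End SkewEval.

(** The skew polynomial with coefficients [lam], with the operator D_a put for its variable, applied
    to [y]. Indexing [lam] by [nat] lets division lower [k] without casts. *)
Definition skew_eval (S : comNzRingType) (sigma : S -> S) k (lam : nat -> S) (a y : S) :=
  \sum_(s < k) lam s * Dop sigma a s y.

Section SkewRoots.
Variables (S : comUnitRingType) (sigma : {rmorphism S -> S}).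
Hypothesis nonunitD : forall x y : S,
  x \isn't a GRing.unit -> y \isn't a GRing.unit -> x + y \isn't a GRing.unit.

Lemma nonunitN (x : S) : x \isn't a GRing.unit -> - x \isn't a GRing.unit.
Proof. by rewrite unitrN. Qed.

Lemma nonunitB (x y : S) :
  x \isn't a GRing.unit -> y \isn't a GRing.unit -> x - y \isn't a GRing.unit.
Proof. by move=> nx /nonunitN; apply: nonunitD. Qed.

Lemma nonunit_sum (J : Type) (r : seq J) (P : pred J) (F : J -> S) :
  (forall j, P j -> F j \isn't a GRing.unit) ->
  \sum_(j <- r | P j) F j \isn't a GRing.unit.
Proof.
move=> nF; elim/big_ind: _ => //; exact: nonunit0.
Qed.

(* Right division of sum_s lam_s X^s by X - b in the skew polynomial ring. *)
Lemma skew_divXsub (b : S) k (lam : nat -> S) : exists mu r,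
  (forall a y, skew_eval sigma k.+1 lam a y =
     skew_eval sigma k mu a (sigma y * a - b * y) + r * y) /\
  ((forall s, (s < k)%N -> mu s \isn't a GRing.unit) -> r \isn't a GRing.unit ->
   forall s, (s < k.+1)%N -> lam s \isn't a GRing.unit).
Proof.
elim: k lam => [|k IH] lam.
  exists (fun=> 0), (lam 0%N); split=> [a y | _ nr [|s]] //.
  by rewrite /skew_eval big_ord1 big_ord0 Dop0 add0r.
(* The top term is cancelled by X^(k+1) = X^k (X - b) + sigma^k(b) X^k: [lam k.+1] becomes the
   leading coefficient of the quotient, and the rest is absorbed in degree [k]. *)
pose lam' s := if s == k then lam k + lam k.+1 * iter k sigma b else lam s.
have [mu [r [eq_ev nu]]] := IH lam'.
pose mu' s := if s == k then lam k.+1 else mu s.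
exists mu', r; split=> [a y | nmu nr].
  have evl (f g : nat -> S) z : (forall s, (s < k)%N -> f s = g s) ->
      \sum_(s < k) f s * Dop sigma a s z = \sum_(s < k) g s * Dop sigma a s z.
    by move=> efg; apply: eq_bigr => s _; rewrite efg.
  have := eq_ev a y; rewrite /skew_eval !big_ord_recr /=.
  rewrite (evl lam' lam) => [|s lt_sk]; last by rewrite /lam' ltn_eqF.
  rewrite (evl mu' mu) => [|s lt_sk]; last by rewrite /mu' ltn_eqF.
  rewrite /lam' /mu' eqxx => eq_sum; rewrite [RHS]addrAC -eq_sum DopS DopB.
  by rewrite [Dop _ _ _ (b * y)]DopM; ring.
have nk : lam k.+1 \isn't a GRing.unit by have := nmu _ (ltnSn k); rewrite /mu' eqxx.
have nlam' s : (s < k.+1)%N -> lam' s \isn't a GRing.unit.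
  apply: nu => // s' lt_s'; by have := nmu _ (ltnW lt_s'); rewrite /mu' ltn_eqF.
move=> s; rewrite ltnS leq_eqVlt => /predU1P[-> // | lt_s].
have := nlam' s lt_s; rewrite /lam'; case: eqP => // -> n'.
by rewrite -(addrK (lam k.+1 * iter k sigma b) (lam k)) nonunitB // nonunitMr.
Qed.

Variables (R : comUnitRingType) (iota : {rmorphism R -> S}).
Hypothesis sigma_iota : forall r, sigma (iota r) = iota r.
Hypothesis sigma_fix : forall y, sigma y - y \isn't a GRing.unit ->
  exists r, y - iota r \isn't a GRing.unit.

Variables (I : eqType) (a : I -> S).
Hypothesis a_unit : forall i, a i \is a GRing.unit.
Hypothesis a_nonconj : forall i j, i != j -> forall b, b \is a GRing.unit ->
  a i - sigma b * a j * b^-1 \is a GRing.unit.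

Variables (T : finType) (tg : T -> I).

(** Independence over the residue field within each fibre of [tg], expressed through nonunits rather
    than in quotient rings. *)
Definition indep_mod (Z : {set T}) (beta : T -> S) := forall i (c : T -> R),
  \sum_(p in Z | tg p == i) iota (c p) * beta p \isn't a GRing.unit ->
  forall p, p \in Z -> tg p = i -> c p \isn't a GRing.unit.

Lemma indep_mod_unit Z beta p : indep_mod Z beta -> p \in Z -> beta p \is a GRing.unit.
Proof.
move=> indZ pZ; apply/negPn/negP => nb.
suff /indZ/(_ p pZ erefl) : \sum_(p' in Z | tg p' == tg p)
  iota (if p' == p then 1 else 0) * beta p' \isn't a GRing.unit by rewrite eqxx unitr1.
rewrite (bigD1 p) ?pZ ?eqxx //= rmorph1 mul1r big1 ?addr0 // => p' /andP[_ /negPf->].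
by rewrite rmorph0 mul0r.
Qed.

Lemma skew_root_bound k lam Z beta :
  indep_mod Z beta -> (k <= #|Z|)%N ->
  (forall p, p \in Z -> skew_eval sigma k lam (a (tg p)) (beta p) \isn't a GRing.unit) ->
  forall s, (s < k)%N -> lam s \isn't a GRing.unit.
Proof.
elim: k lam Z beta => // k IH lam Z beta indZ leZ roots.
have /card_gt0P[p0 p0Z] : (0 < #|Z|)%N by apply: leq_trans leZ.
have u0 : beta p0 \is a GRing.unit by apply: indep_mod_unit indZ _.
have usig y : y \is a GRing.unit -> sigma y \is a GRing.unit by apply: rmorph_unit.
(* With this [b] the quotient is evaluated at 0 for the point [p0], so only [r * beta p0] survives
   there. *)
pose i0 := tg p0; pose b := sigma (beta p0) * a i0 * (beta p0)^-1.
have [mu [r [eq_ev nlam]]] := skew_divXsub b k lam.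
have nr : r \isn't a GRing.unit.
  have := roots p0 p0Z; rewrite eq_ev -/i0 divrK // subrr.
  rewrite (_ : skew_eval _ _ _ _ 0 = 0); last first.
    by apply: big1 => s _; rewrite Dop_zero mulr0.
  by rewrite add0r; apply: contra => ur; rewrite unitrM ur.
apply: nlam => //; pose phi p y := sigma y * a (tg p) - b * y.
apply: (IH mu (Z :\ p0) (fun p => phi p (beta p))); last first.
- move=> p; rewrite !inE => /andP[_ pZ].
  have -> : skew_eval sigma k mu (a (tg p)) (phi p (beta p)) =
      skew_eval sigma k.+1 lam (a (tg p)) (beta p) - r * beta p by rewrite eq_ev addrK.
  by apply: nonunitB; [apply: roots | apply: nonunitMr].
- by rewrite (cardsD1 p0) p0Z in leZ.
(* On one block [phi] is additive and commutes with scalars from R, so a combination of the new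
   points is the image of the same combination [G] of the old ones. *)
move=> i c; set G := \sum_(p in Z :\ p0 | tg p == i) iota (c p) * beta p.
have -> : \sum_(p in Z :\ p0 | tg p == i) iota (c p) * phi p (beta p) =
    sigma G * a i - b * G.
  rewrite /G rmorph_sum mulr_suml mulr_sumr -sumrB; apply: eq_bigr => p /andP[_ /eqP tp].
  by rewrite /phi tp rmorphM sigma_iota; ring.
move=> nG p; rewrite !inE => /andP[np0 pZ] tp.
(* In the block of [p0], a nonunit image means that [G / beta p0] is fixed by [sigma] modulo
   nonunits, hence congruent to some [iota r1]. This is a relation among the old points, with
   coefficient [- r1] at [p0]. *)
have [ei | ni] := eqVneq i i0.
  have eG : sigma (G / beta p0) - G / beta p0 =
      (sigma G * a i - b * G) * (sigma (beta p0))^-1 * (a i0)^-1.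
    rewrite ei rmorphM rmorphV // /b.
    set u := beta p0; set w := a i0.
    transitivity (sigma G * (sigma u)^-1 * (w * w^-1)
                  - u^-1 * G * (sigma u * (sigma u)^-1) * (w * w^-1)); last by ring.
    by rewrite !divrr ?usig ?a_unit // !mulr1 [G * _]mulrC.
  have [|r1 nr1] := sigma_fix (y := G / beta p0).
    by rewrite eG; do 2 apply: nonunitMr.
  have nG1 : G - iota r1 * beta p0 \isn't a GRing.unit.
    by rewrite -[G](divrK u0) -mulrBl nonunitMr.
  pose c' p' := if p' == p0 then - r1 else c p'.
  have := indZ i0 c' _ p pZ; rewrite /c' (negPf np0); apply; last by rewrite -ei.
  rewrite (bigD1 p0) ?p0Z ?eqxx //= rmorphN mulNr addrC.
  apply: etrans nG1; congr (~~ (_ - _ \is a _)).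
  rewrite /G; apply: eq_big => [p' | p' /andP[_ /negPf->] //].
  by rewrite !inE ei andbC andbA.
(* In another block, a unit [G] would have the image [sigma G] times the difference of [a i] and the
   conjugate of [a i0] by [beta p0 / G], which is a unit. *)
have [uG | nuG] := boolP (G \is a GRing.unit); last first.
  apply: (indZ i c _ p pZ tp).
  apply: etrans nuG; congr (~~ (_ \is a _)); apply: eq_bigl => p'.
  rewrite !inE; case: (eqVneq p' p0) => //= ->.
  by rewrite -/i0 eq_sym (negPf ni) andbF.
suff : sigma G * a i - b * G \is a GRing.unit by rewrite (negPf nG).
have uy : beta p0 / G \is a GRing.unit by rewrite unitrM u0 unitrV.
have := a_nonconj ni uy; rewrite rmorphM rmorphV // invrM ?unitrV // invrK => unc.
suff -> : sigma G * a i - b * G = sigma G *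
    (a i - sigma (beta p0) * (sigma G)^-1 * a i0 * (G / beta p0)) by rewrite unitrM usig.
rewrite mulrBr; congr (_ - _).
transitivity (b * G * (sigma G * (sigma G)^-1)); first by rewrite divrr ?usig ?mulr1.
by rewrite /b; set u := (beta p0)^-1; set v := (sigma G)^-1; ring.
Qed.

End SkewRoots.

(** * The Galois extension *)

Section Extension.
Variables (R S : finComUnitRingType) (h : {poly R}) (m : nat).
Variables (iota : {rmorphism R -> S}) (x : S).
Hypothesis chainR : is_chain_ring R.
Hypothesis h_monic : h \is monic.
Hypothesis size_h : size h = m.+1.
Hypothesis m_gt0 : (0 < m)%N.
Hypothesis h_irr : irreducible_mod_max h.
Hypothesis eval_onto : forall s : S, exists p : {poly R}, s = (map_poly iota p).[x].
Hypothesis eval_ker : forall p : {poly R},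
  (map_poly iota p).[x] = 0 <-> exists g, p = g * h.

Let ev (p : {poly R}) := (map_poly iota p).[x].

Let evD p q : ev (p + q) = ev p + ev q.
Proof. by rewrite /ev rmorphD hornerD. Qed.

Let evM p q : ev (p * q) = ev p * ev q.
Proof. by rewrite /ev rmorphM hornerM. Qed.

Lemma ext_coords s : exists c : 'I_m -> R, s = \sum_(i < m) iota (c i) * x ^+ i.
Proof.
have [p ->] := eval_onto s; exists (fun i => (rmodp p h)`_i).
have [_ /(_ (ex_intro _ (rdivp p h) erefl)) evh] := eval_ker (rdivp p h * h).
have -> : (map_poly iota p).[x] = ev (rmodp p h).
  by rewrite {1}(Pdiv.RingMonic.rdivp_eq h_monic p) -/(ev _) evD [ev (_ * _)]evh add0r.
rewrite /ev (@horner_coef_wide _ m); first by apply: eq_bigr => i _; rewrite coef_map.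
apply: leq_trans (size_poly _ _) _; rewrite -ltnS -size_h.
by rewrite ltn_rmodp monic_neq0.
Qed.

(** The coordinates form a polynomial of size at most [m] that is a multiple of the monic [h] of
    size [m.+1], hence zero. *)
Lemma ext_coords_inj (c : 'I_m -> R) :
  \sum_(i < m) iota (c i) * x ^+ i = 0 -> forall i, c i = 0.
Proof.
case: m size_h c => [|m1] size_h1 c; first by move=> _ [].
move=> sum0 i; pose p := \poly_(j < m1.+1) c (inord j).
have pE (j : 'I_m1.+1) : p`_j = c j by rewrite coef_poly ltn_ord inord_val.
have szp : (size p <= m1.+1)%N by apply: size_poly.
have /eval_ker[g eg] : (map_poly iota p).[x] = 0.
  rewrite (@horner_coef_wide _ m1.+1).
    by rewrite -[RHS]sum0; apply: eq_bigr => j _; rewrite coef_map pE.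
  by apply: leq_trans (size_poly _ _) _.
rewrite -pE eg; have [-> | g0] := eqVneq g 0; first by rewrite mul0r coef0.
move: szp; rewrite eg size_Mmonic // size_h1 addnS /= => le_m.
by move: g0; rewrite -size_poly_gt0 -(ltn_add2r m1.+1) add0n ltnNge le_m.
Qed.

Lemma ext_inj : injective iota.
Proof.
case: m m_gt0 ext_coords_inj => // m1 _ inj0 r1 r2 e.
have := inj0 (fun i => if i == 0 then r1 - r2 else 0).
rewrite big_ord_recl /= expr0 mulr1 rmorphB e subrr add0r.
rewrite big1 => [|i _]; last by rewrite rmorph0 mul0r.
by move=> /(_ erefl 0) /= /eqP; rewrite subr_eq0 => /eqP.
Qed.

Variable rho : R.
Hypothesis rho_neq0 : rho != 0.
Hypothesis rho_nonunit : forall z, z \isn't a GRing.unit -> rho * z = 0.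
Hypothesis rho_dvd : forall r, r != 0 -> exists c, rho = c * r.

(** Some coordinate [r] divides all coordinates of the family. Writing [rho = d * r], multiplication
    by [d] sends every member to a multiple of [rho] and turns the coordinate [r] into [rho], so not
    all members die. *)
Lemma ext_socle_family (J : finType) (lam : J -> S) (j0 : J) : lam j0 != 0 ->
  exists d lam', (forall j, iota d * lam j = iota rho * lam' j) /\
                 (exists j, iota d * lam j != 0).
Proof.
move=> nz.
have [c cE] := fin_all_exists (fun j => ext_coords (lam j)).
pose i0 := Ordinal m_gt0.
have [[j1 i1] dvd] := chain_common_divisor chainR (fun p : J * 'I_m => c p.1 p.2) (j0, i0).
have [e eE] := fin_all_exists dvd.
have r0 : c j1 i1 != 0.
  apply: contraNneq nz => z; rewrite cE big1 // => i _.
  by rewrite (eE (j0, i)) /= z mulr0 rmorph0 mul0r.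
have [d dE] := rho_dvd r0.
exists d, (fun j => \sum_(i < m) iota (e (j, i)) * x ^+ i); split=> [j|].
  rewrite cE !mulr_sumr; apply: eq_bigr => i _.
  by rewrite (eE (j, i)) dE /= !rmorphM; ring.
exists j1; apply: contraNneq rho_neq0; rewrite cE mulr_sumr => z.
rewrite dE; apply/eqP; apply: (@ext_coords_inj (fun i => d * c j1 i) _ i1).
rewrite -[RHS]z.
by apply: eq_bigr => i _; rewrite rmorphM mulrA.
Qed.

Let nonunitp (p : {poly R}) := forall i, p`_i \isn't a GRing.unit.

Let ev_socle p : nonunitp p -> iota rho * ev p = 0.
Proof.
move=> np; rewrite /ev horner_coef mulr_sumr big1 // => i _.
by rewrite coef_map mulrA -rmorphM rho_nonunit ?np // rmorph0 mul0r.
Qed.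

(** Cut [p] at its last unit coefficient and normalize: what is dropped has only nonunit
    coefficients. *)
Let monic_part (p : {poly R}) i : p`_i \is a GRing.unit -> exists c g,
  [/\ g \is monic, (size g <= size p)%N, c \is a GRing.unit & nonunitp (p - c *: g)].
Proof.
move=> ui; have ltip : (i < size p)%N.
  by rewrite ltnNge; apply/negP => /(nth_default 0) z; rewrite z unitr0 in ui.
case: (@arg_maxnP _ (Ordinal ltip) (fun j => p`_j \is a GRing.unit) id ui) => j uj jmax.
have g1 : (p`_j)^-1 * p`_j != 0 by rewrite mulVr ?oner_neq0.
exists p`_j, (\poly_(i < j.+1) ((p`_j)^-1 * p`_i)); split=> //.
- by rewrite monicE lead_coef_poly // mulVr.
- by rewrite size_poly_eq.
move=> n; rewrite coefB coefZ coef_poly; case: ltnP => [_|lt_jn].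
  by rewrite mulVKr // subrr unitr0.
rewrite mulr0 subr0; apply/negP => un.
have ltnp : (n < size p)%N.
  by rewrite ltnNge; apply/negP => /(nth_default 0) z; rewrite z unitr0 in un.
by have := jmax (Ordinal ltnp) un; rewrite /= leqNgt lt_jn.
Qed.

(** * Euclid's algorithm against h modulo the maximal ideal *)

Section Euclid.
Variable s : S.
(** The polynomials whose value at [x] lies in the ideal generated by [s], up to an error with
    nonunit coefficients. They form an ideal containing [h]. *)
Let J p := exists u w, nonunitp w /\ ev p = u * s + ev w.

Let nonunitpD p q : nonunitp p -> nonunitp q -> nonunitp (p + q).
Proof. by move=> np nq i; rewrite coefD (chain_nonunitD chainR). Qed.

Let nonunitpMl p q : nonunitp q -> nonunitp (p * q).
Proof.
move=> nq i; rewrite coefM.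
by apply: (nonunit_sum (chain_nonunitD chainR)) => j _; apply: nonunitMl.
Qed.

Let JD p q : J p -> J q -> J (p + q).
Proof.
move=> [u [w [nw e]]] [v [t [nt f]]]; exists (u + v), (w + t).
split; first exact: nonunitpD.
by rewrite !evD e f; ring.
Qed.

Let JM p q : J q -> J (p * q).
Proof.
move=> [u [w [nw e]]]; exists (ev p * u), (p * w).
split; first exact: nonunitpMl.
by rewrite !evM e; ring.
Qed.

Let Jnonunit p : nonunitp p -> J p.
Proof. by move=> np; exists 0, p; rewrite mul0r add0r. Qed.

Let Jh : J h.
Proof.
exists 0, 0; split; first by move=> i; rewrite coef0 unitr0.
rewrite mul0r add0r /ev rmorph0 horner0.
by apply/eval_ker; exists 1; rewrite mul1r.
Qed.

Let J_monic_part (p : {poly R}) i : p`_i \is a GRing.unit -> J p ->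
  exists2 g, g \is monic /\ J g & (size g <= size p)%N.
Proof.
move=> /monic_part[c [g [mg szg uc nw]]] Jp; exists g => //; split=> //.
have -> : g = c^-1%:P * (p + (-1) * (p - c *: g)).
  by rewrite mulN1r opprB addrC subrK mul_polyC scalerA mulVr // scale1r.
by apply: JM; apply: JD => //; apply: JM; apply: Jnonunit.
Qed.

(* J 1 is reached because a remainder that vanishes modulo the maximal ideal
   would factor h. *)
Let euclid n (g : {poly R}) : (size g <= n)%N -> g \is monic -> J g -> (size g <= m)%N -> J 1.
Proof.
elim: n g => [|n IH] g.
  by rewrite leqn0 size_poly_eq0 => /eqP-> /monic_neq0; rewrite eqxx.
move=> szg mg Jg leg; pose r := rmodp h g; pose q := rdivp h g.
have hE : h = q * g + r by apply: Pdiv.RingMonic.rdivp_eq.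
have ltr : (size r < size g)%N by rewrite ltn_rmodp monic_neq0.
have [/existsP[i ui] | /existsPn nr] :=
    boolP [exists i : 'I_(size r), r`_i \is a GRing.unit].
  have [|g' [mg' Jg'] szg'] := J_monic_part ui.
    have -> : r = h + (- q) * g by rewrite hE mulNr addrAC subrr add0r.
    by apply: JD => //; apply: JM.
  have lt' := leq_ltn_trans szg' ltr.
  apply: (IH g') => //; first by rewrite -ltnS; apply: leq_trans lt' _.
  exact: leq_trans (ltnW lt') _.
have nrp : nonunitp r.
  move=> i; have [lti|gei] := ltnP i (size r); first exact: (nr (Ordinal lti)).
  by rewrite nth_default ?unitr0.
have lead1 (p : {poly R}) : lead_coef p = 1 -> (1 < size p)%N ->
    ~ (forall i, (0 < i)%N -> p`_i \isn't a GRing.unit).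
  move=> lp szp /(_ (size p).-1); rewrite -lead_coefE lp unitr1.
  by case: (size p) szp => [|[|?]] // _ /(_ isT).
case: (h_irr (f := q) (g := g)).
- by move=> i; rewrite hE addrC addKr.
(* As [g] has size at most [m], the quotient [q] has size at least 2; its leading coefficient 1 then
   contradicts being constant modulo nonunits. *)
- have qg : q * g = h - r by rewrite hE addrK.
  have szhr : (size (- r) < size h)%N.
    by rewrite size_polyN size_h; apply: leq_trans ltr (leq_trans leg _).
  move/lead1; case.
    by rewrite -(lead_coef_Mmonic _ mg) qg lead_coefDl //; apply/eqP.
  have q0 : q != 0.
    apply: contraTneq szhr => q0; rewrite -leqNgt size_polyN.
    by rewrite hE q0 mul0r add0r.
  have szqg : size (q * g) = m.+1 by rewrite qg size_polyDl.
  rewrite size_Mmonic // in szqg; rewrite ltnNge; apply/negP => leq1.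
  suff : ((size q + size g).-1 <= m)%N by rewrite szqg ltnn.
  by rewrite -subn1 leq_subLR leq_add.
(* A monic [g] that is constant modulo nonunits is 1, so [J g] is the goal. *)
- move/(lead1 g (eqP mg)) => n1.
  have sz1 : (size g <= 1)%N by rewrite leqNgt; apply/negP.
  have := Jg; rewrite (size1_polyC sz1).
  suff -> : g`_0 = 1 by [].
  have := eqP mg; rewrite lead_coefE.
  by case: (size g) sz1 => [|[|?]].
Qed.

Lemma ext_unit_coord (c : 'I_m -> R) i :
  s = \sum_(i < m) iota (c i) * x ^+ i -> c i \is a GRing.unit -> s \is a GRing.unit.
Proof.
move=> sE uc; pose p := \poly_(j < m) oapp c 0 (insub j).
have pE (j : 'I_m) : p`_j = c j by rewrite coef_poly ltn_ord valK.
have szp : (size p <= m)%N by apply: size_poly.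
have Jp : J p.
  exists 1, 0; split; first by move=> j; rewrite coef0 unitr0.
  rewrite /ev rmorph0 horner0 addr0 mul1r sE (@horner_coef_wide _ m).
    by apply: eq_bigr => j _; rewrite coef_map pE.
  exact: leq_trans (size_poly _ _) _.
have up : p`_i \is a GRing.unit by rewrite pE.
have [g [mg Jg] szg] := J_monic_part up Jp.
have [u [w [nw]]] := euclid (leqnn _) mg Jg (leq_trans szg szp).
rewrite /ev rmorph1 hornerC => e1.
(* If [s * y = 0], then [y = ev w * y]. A nonzero multiple of [y] lies in [iota rho * S], yet
   [iota rho * ev w = 0] kills it. *)
apply: unit_of_lreg => y sy0; apply/eqP/negPn/negP => y0.
have [d [lam' [eqd [_ ny]]]] := ext_socle_family (lam := fun _ : unit => y) (j0 := tt) y0.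
case/eqP: ny; rewrite -[y]mul1r e1 mulrDl -mulrA sy0 mulr0 add0r.
by rewrite mulrCA (eqd tt) mulrCA mulrA ev_socle ?mul0r.
Qed.

End Euclid.

(** A nonunit has only nonunit coordinates, all killed by [rho]; a unit cannot kill the nonzero
    [iota rho]. *)
Lemma ext_nonunitE s : (s \isn't a GRing.unit) = (iota rho * s == 0).
Proof.
have [c sE] := ext_coords s.
apply/idP/eqP => [ns | rs0].
  rewrite sE mulr_sumr big1 // => i _; rewrite mulrA -rmorphM.
  rewrite rho_nonunit ?rmorph0 ?mul0r //.
  by apply: contra ns; apply: ext_unit_coord sE.
apply/negP => us; case/eqP: rho_neq0.
have r0 : iota rho = 0 by rewrite -[LHS]mulr1 -(divrr us) mulrA rs0 mul0r.
by apply: ext_inj; rewrite r0 rmorph0.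
Qed.

Lemma ext_nonunitD (y z : S) :
  y \isn't a GRing.unit -> z \isn't a GRing.unit -> y + z \isn't a GRing.unit.
Proof. by rewrite !ext_nonunitE mulrDr => /eqP-> /eqP->; rewrite addr0. Qed.

Lemma ext_unit1B (y : S) : y \isn't a GRing.unit -> 1 - y \is a GRing.unit.
Proof.
move=> ny; apply/negPn/negP => /ext_nonunitD /(_ ny).
by rewrite subrK unitr1.
Qed.

Variable sigma : {rmorphism S -> S}.
Hypothesis sigma_iota : forall r, sigma (iota r) = iota r.
Hypothesis sigma_fixed : forall s, sigma s = s -> exists r, s = iota r.
Hypothesis sigma_frob : forall y : S, sigma y - y ^+ residue_card R \isn't a GRing.unit.

(* As q lies in the maximal ideal, replacing y by y ^+ q multiplies [sigma y - y]
   by a nonunit; by finiteness it eventually vanishes, and y is unchanged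
   modulo the maximal ideal. *)
Lemma ext_sigma_fix_mod y : sigma y - y \isn't a GRing.unit ->
  exists r, y - iota r \isn't a GRing.unit.
Proof.
have nonunitB := nonunitB ext_nonunitD.
(* Induction on the size of the ideal generated by [sigma y - y]. *)
pose M z := #|[set z * t | t : S]|.
have [n] := ubnP (M (sigma y - y)); elim: n y => // n IH y lt_n ny.
have [e|ne] := eqVneq (sigma y) y.
  by have [r ->] := sigma_fixed e; exists r; rewrite subrr unitr0.
have frob := sigma_frob; set q := residue_card R in frob *.
have nq : q%:R \isn't a (@GRing.unit S).
  rewrite ext_nonunitE -(rmorph_nat iota) -rmorphM.
  by rewrite rho_nonunit ?rmorph0 //; apply: residue_card_nonunit.
have pow_mod i : sigma y ^+ i - y ^+ i \isn't a GRing.unit.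
  by rewrite subrXX nonunitMr.
(* The cofactor of [sigma y - y] in [sigma y ^+ q - y ^+ q]. Modulo nonunits it is
   [q%:R * y ^+ q.-1], itself a nonunit. *)
pose w := \sum_(i < q) sigma y ^+ (q.-1 - i) * y ^+ i.
have nw : w \isn't a GRing.unit.
  have -> : w = \sum_(i < q) (sigma y ^+ (q.-1 - i) - y ^+ (q.-1 - i)) * y ^+ i
               + q%:R * y ^+ q.-1.
    rewrite /w; have -> : q%:R * y ^+ q.-1 = \sum_(i < q) y ^+ (q.-1 - i) * y ^+ i.
      transitivity (\sum_(i < q) y ^+ q.-1); first by rewrite sumr_const card_ord mulr_natl.
      apply: eq_bigr => i _.
      by rewrite -exprD subnK // -ltnS (ltn_predK (ltn_ord i)).
    by rewrite -big_split; apply: eq_bigr => i _ /=; rewrite mulrBl subrK.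
  apply: ext_nonunitD; last exact: nonunitMr.
  by apply: (nonunit_sum ext_nonunitD) => i _; apply: nonunitMr.
have eqw : sigma (y ^+ q) - y ^+ q = (sigma y - y) * w by rewrite rmorphXn subrXX.
have [|| r nr] := IH (y ^+ q).
- rewrite -ltnS; apply: leq_trans lt_n; rewrite ltnS eqw.
  apply: proper_card; apply/properP; split.
    by apply/subsetP => _ /imsetP[t _ ->]; apply/imsetP; exists (w * t); rewrite ?mulrA.
  exists (sigma y - y); first by apply/imsetP; exists 1; rewrite ?mulr1.
  apply/imsetP => -[t _ e]; case/eqP: ne; apply/eqP; rewrite -subr_eq0; apply/eqP.
  have u1 : 1 - w * t \is a GRing.unit by apply: ext_unit1B; apply: nonunitMr.
  by apply: (mulIr u1); rewrite mul0r mulrBr mulr1 mulrA -e subrr.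
- by rewrite eqw nonunitMl.
exists r; have -> : y - iota r =
  (sigma y - y ^+ q) - (sigma y - y) + (y ^+ q - iota r) by ring.
by apply: ext_nonunitD => //; apply: nonunitB.
Qed.

Variables (l : nat) (a : 'I_l -> S).
Hypothesis a_unit : forall i, a i \is a GRing.unit.
Hypothesis a_nonconj : forall i j, i != j -> forall b, b \is a GRing.unit ->
  a i - sigma b * a j * b^-1 \is a GRing.unit.

(** Scale a nonzero coefficient family to [iota rho * lam'], not all zero. Then [lam'] has the given
    points as roots modulo nonunits, so [skew_root_bound] makes each [lam'] a nonunit, killed by
    [rho]. *)
Lemma ext_skew_roots (T : finType) (tg : T -> 'I_l) (Z : {set T}) (beta : T -> S) k lam :
  (forall i (c : T -> R), \sum_(p in Z | tg p == i) iota (c p) * beta p = 0 ->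
     forall p, p \in Z -> tg p = i -> c p = 0) ->
  (k <= #|Z|)%N ->
  (forall p, p \in Z -> skew_eval sigma k lam (a (tg p)) (beta p) = 0) ->
  forall s, (s < k)%N -> lam s = 0.
Proof.
move=> ind leZ roots s lt_s; apply/eqP/negPn/negP => nz.
have [d [lam' [eqd [[s' lt_s'] nzs']]]] :=
  ext_socle_family (lam := fun s : 'I_k => lam s) (j0 := Ordinal lt_s) nz.
pose mu t := oapp lam' 0 (insub t).
have muE (t : 'I_k) : mu t = lam' t by rewrite /mu valK.
case/eqP: nzs'; rewrite eqd -muE; apply/eqP; rewrite -ext_nonunitE.
apply: (skew_root_bound ext_nonunitD sigma_iota ext_sigma_fix_mod a_unit a_nonconj
          (tg := tg) (Z := Z) (beta := beta)) lt_s' => // [i c | p pZ].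
  (* Multiplying a relation modulo nonunits by [rho] makes it exact; then [rho * c p = 0] prevents
     [c p] from being a unit. *)
  rewrite ext_nonunitE mulr_sumr => /eqP sum0 p pZ tp.
  apply/negP => uc; case/eqP: rho_neq0; apply: (mulIr uc); rewrite mul0r.
  apply: (ind i (fun p => rho * c p)) pZ tp; rewrite -[RHS]sum0.
  by apply: eq_bigr => p' _; rewrite rmorphM mulrA.
rewrite ext_nonunitE mulr_sumr; apply/eqP.
transitivity (iota d * skew_eval sigma k lam (a (tg p)) (beta p)).
  by rewrite mulr_sumr; apply: eq_bigr => t _; rewrite muE !mulrA eqd.
by rewrite roots ?mulr0.
Qed.

End Extension.

(** * Sum-rank weight of the codewords *)

Section BigMin.
Variables (I : finType) (n : nat) (P : pred I) (F : I -> nat).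

Lemma bigminn_le i : P i -> (\big[minn/n]_(j | P j) F j <= F i)%N.
Proof.
move=> Pi; have := mem_index_enum i; rewrite unlock.
elim: (index_enum I) => //= j s IH; rewrite inE => /predU1P[<-|/IH le_s].
  by rewrite Pi geq_minl.
by case: ifP => // _; rewrite geq_min le_s orbT.
Qed.

Lemma bigminn_eq : \big[minn/n]_(j | P j) F j = n \/
  exists2 i, P i & \big[minn/n]_(j | P j) F j = F i.
Proof.
elim/big_rec: _ => [|i y Pi IH]; first by left.
by case: (leqP (F i) y) => _; [right; exists i | exact: IH].
Qed.

(** If the minimum equals the default [n], then [F i <= n] forces [F i] itself to be the minimum. *)
Lemma bigminn_attained i : P i -> (F i <= n)%N ->
  exists2 j, P j & \big[minn/n]_(j | P j) F j = F j.
Proof.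
move=> Pi le_n; case: bigminn_eq => // e; exists i => //.
by apply/eqP; rewrite eqn_leq bigminn_le //= e.
Qed.

Lemma le_bigminn b : (b <= n)%N -> (forall i, P i -> (b <= F i)%N) ->
  (b <= \big[minn/n]_(j | P j) F j)%N.
Proof. by move=> le_n le_F; case: bigminn_eq => [|[i Pi]] ->; rewrite ?le_F. Qed.

End BigMin.

(** * Rank of a block through its coordinate matrix *)

Section Rank.
Variables (R S : finComUnitRingType) (iota : {rmorphism R -> S}) (x : S) (m : nat).
Hypothesis chainR : is_chain_ring R.
Hypothesis coords : forall s, exists c : 'I_m -> R, s = \sum_(i < m) iota (c i) * x ^+ i.
Hypothesis coords_inj : forall c : 'I_m -> R,
  \sum_(i < m) iota (c i) * x ^+ i = 0 -> forall i, c i = 0.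

Let chain_snf_count t (C : 'M[R]_(m, t)) : exists2 r : 'I_(minn m t).+1,
  snf_count C r & (r <= #|nz_cols C|)%N.
Proof.
have [P [Q [D [uP uQ eC snfD leD]]]] := chain_snf C chainR.
have ltr : (diag_nz D < (minn m t).+1)%N.
  rewrite ltnS leq_min (leq_trans (max_card _)) ?card_ord //=.
  by rewrite (leq_trans leD) // (leq_trans (max_card _)) ?card_ord.
exists (Ordinal ltr) => //; apply/existsP; exists P; apply/existsP; exists Q.
by apply/existsP; exists D; rewrite uP uQ -eC snfD !eqxx.
Qed.

(* The default values of the minima defining mxrk and rk are never needed:
   Smith forms and coordinate matrices exist. *)
Lemma mxrk_attained t (C : 'M[R]_(m, t)) : snf_count C (mxrk C).
Proof.
have [r snfr _] := chain_snf_count C.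
have [|r' snfr' e] := @bigminn_attained _ (minn m t)
  (fun r : 'I_(minn m t).+1 => snf_count C r) val r snfr.
  by rewrite /= -ltnS.
by rewrite /mxrk e.
Qed.

Lemma mxrk_le_nz_cols t (C : 'M[R]_(m, t)) : (mxrk C <= #|nz_cols C|)%N.
Proof.
have [r snfr ler] := chain_snf_count C.
by apply: leq_trans ler; apply: (@bigminn_le _ _ _ val).
Qed.

Lemma mxrk_le_rows t (C : 'M[R]_(m, t)) : (mxrk C <= m)%N.
Proof.
have /existsP[P /existsP[Q /existsP[D /and5P[_ _ _ _ /eqP <-]]]] := mxrk_attained C.
by apply: leq_trans (max_card _) _; rewrite card_ord.
Qed.

(** The only possible nonzero entry of a column is diagonal, so nonzero columns inject into nonzero
    diagonal positions. *)
Lemma snf_nz_cols t (D : 'M[R]_(m, t)) : is_snf D -> (#|nz_cols D| <= diag_nz D)%N.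
Proof.
move=> /is_snfP[diag _].
pose f (j : 'I_t) : option 'I_m := insub (j : nat).
have fP j i : D i j != 0 -> f j = Some i /\ i = j :> nat.
  move=> nz; have e : i = j :> nat by apply/eqP; apply: contraNT nz => /diag ->.
  by rewrite /f -e valK.
rewrite -(card_in_imset (f := f) (D := mem (nz_cols D))); last first.
  move=> j j' /nz_colsP[i /fP[-> e]] /nz_colsP[i' /fP[-> e']] [ei].
  by apply: val_inj; rewrite /= -e -e' ei.
pose X := [set i : 'I_m | [exists j : 'I_t, (i == j :> nat) && (D i j != 0)]].
have -> : diag_nz D = #|[set Some i | i in X]| by rewrite card_imset //; apply: Some_inj.
apply/subset_leq_card/subsetP => _ /imsetP[j /nz_colsP[i nz] ->].
have [-> e] := fP _ _ nz; apply: imset_f; rewrite inE; apply/existsP; exists j.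
by rewrite e eqxx.
Qed.

Let rk_mxrk t (u : 'I_t -> S) : exists2 C : 'M[R]_(m, t),
  forall j, u j = \sum_(i < m) iota (C i j) * x ^+ i & rk iota x m u = mxrk C.
Proof.
have [c cE] := fin_all_exists (fun j => coords (u j)).
pose C : 'M[R]_(m, t) := \matrix_(i, j) c j i.
have [|| C' /forallP C'P e] := @bigminn_attained _ m
    (fun C : 'M[R]_(m, t) => [forall j, u j == \sum_(i < m) iota (C i j) * x ^+ i])
    (@mxrk R m t) C.
- by apply/forallP=> j; rewrite cE; apply/eqP/eq_bigr => i _; rewrite mxE.
- exact: mxrk_le_rows.
by exists C' => // j; apply/eqP.
Qed.

(** If [C = P *m D *m Q], then [C *m invmx Q = P *m D] vanishes in every column where [D] does. *)
Lemma rk_zero_combs t (u : 'I_t -> S) : exists2 Q : 'M[R]_t, Q \in unitmx &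
  (t <= rk iota x m u + #|[set j | (\sum_(j' < t) iota (Q j' j) * u j' == 0)%R]|)%N.
Proof.
have [C uE ->] := rk_mxrk u.
have /existsP[P /existsP[Q /existsP[D /and5P[uP uQ /eqP eC snfD /eqP<-]]]] :=
  mxrk_attained C.
exists (invmx Q); first by rewrite unitmx_inv.
rewrite -[X in (X <= _)%N]card_ord -(cardsC (nz_cols D)).
apply: leq_add; first exact: snf_nz_cols.
apply/subset_leq_card/subsetP => j; rewrite !inE negbK => /eqP/colP z.
have zPD i : (P *m D) i j = 0.
  by rewrite mxE big1 // => i' _; have := z i'; rewrite !mxE => ->; rewrite mulr0.
apply/eqP; transitivity (\sum_(i < m) iota ((C *m invmx Q) i j) * x ^+ i); last first.
  by rewrite eC mulmxK // big1 // => i _; rewrite zPD rmorph0 mul0r.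
under eq_bigr do rewrite uE mulr_sumr.
rewrite exchange_big; apply: eq_bigr => i _ /=.
rewrite mxE rmorph_sum mulr_suml; apply: eq_bigr => j' _.
by rewrite rmorphM; ring.
Qed.

Lemma rk_le_supp t (u : 'I_t -> S) : (rk iota x m u <= #|[set j | (u j != 0)%R]|)%N.
Proof.
have [C uE ->] := rk_mxrk u; apply: leq_trans (mxrk_le_nz_cols C) _.
apply/subset_leq_card/subsetP => j /nz_colsP[i]; rewrite inE; apply: contraNneq => uj0.
by apply/eqP; apply: (coords_inj (c := fun i => C i j)); rewrite -uE.
Qed.

Variables (l : nat) (nn : 'I_l -> nat).
Let T : finType := idx nn.

Lemma card_idx_set (A : {set T}) :
  #|A| = (\sum_(i < l) #|[set j : 'I_(nn i) | Tagged (fun i => 'I_(nn i)) j \in A]|)%N.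
Proof.
rewrite -sum1_card; under [RHS]eq_bigr do rewrite -sum1dep_card.
rewrite (sig_big_dep _ (fun i (j : 'I_(nn i)) => Tagged (fun i => 'I_(nn i)) j \in A)).
by apply: eq_bigl => -[].
Qed.

Lemma card_idx : #|T| = ntot nn.
Proof.
rewrite -cardsT card_idx_set; apply: eq_bigr => i _.
by rewrite -[RHS]card_ord; apply: eq_card => j; rewrite !inE.
Qed.

Lemma wtSR_le_supp (c : {ffun T -> S}) : (wtSR iota x m c <= #|[set p | (c p != 0)%R]|)%N.
Proof.
rewrite card_idx_set; apply: leq_sum => i _.
apply: leq_trans (rk_le_supp _) _; apply: subset_leq_card.
by apply/subsetP => j; rewrite !inE.
Qed.

(** * The code and its minimum distance *)

Variable sigma : {rmorphism S -> S}.
Hypothesis sigma_iota : forall r, sigma (iota r) = iota r.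
Variables (a : 'I_l -> S) (beta : forall i : 'I_l, 'I_(nn i) -> S) (k : nat).
Arguments beta : clear implicits.
Hypothesis skew_roots : forall (Z : {set T}) (b : T -> S) lam,
  (forall i (c : T -> R), \sum_(p in Z | tag p == i) iota (c p) * b p = 0 ->
     forall p, p \in Z -> tag p = i -> c p = 0) ->
  (k <= #|Z|)%N ->
  (forall p, p \in Z -> skew_eval sigma k lam (a (tag p)) (b p) = 0) ->
  forall s, (s < k)%N -> lam s = 0.
Hypothesis beta_indep : forall (i : 'I_l) (c : 'I_(nn i) -> R),
  \sum_(j < nn i) iota (c j) * beta i j = 0 -> forall j, c j = 0.
Hypothesis k_gt0 : (0 < k)%N.
Hypothesis k_le : (k <= ntot nn)%N.

Let tg i (j : 'I_(nn i)) : T := Tagged (fun i => 'I_(nn i)) j.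

Let sum_block (Z : {set T}) i (F : T -> S) :
  \sum_(p in Z | tag p == i) F p = \sum_(j < nn i | tg j \in Z) F (tg j).
Proof.
transitivity (\sum_(i' < l) \sum_(j < nn i' | (tg j \in Z) && (i' == i)) F (tg j)).
  rewrite (sig_big_dep _ (fun i' (j : 'I_(nn i')) => (tg j \in Z) && (i' == i))
            (fun i' (j : 'I_(nn i')) => F (tg j))).
  by apply: eq_big => -[].
rewrite (bigD1 i) //= [X in _ + X]big1 ?addr0 => [|i' /negPf ne].
  by apply: eq_bigl => j; rewrite eqxx andbT.
by apply: big_pred0 => j; rewrite ne andbF.
Qed.

Definition encode (lam : 'I_k -> S) : {ffun T -> S} :=
  [ffun p => \sum_(s < k) lam s * Dop sigma (a (tag p)) s (beta (tag p) (tagged p))].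

(** By contraposition: a weight of at most n - k leaves, over all blocks, at least k vanishing
    combinations of codeword entries, each one a root of the skew polynomial [lam]. *)
Lemma encode_wt (lam : 'I_k -> S) s :
  lam s != 0 -> (ntot nn - k + 1 <= wtSR iota x m (encode lam))%N.
Proof.
apply: contraNT; rewrite -ltnNge addn1 ltnS => le_wt; apply/eqP.
pose u i j := encode lam (@tg i j).
have [Q QP] := fin_all_exists2 (fun i => rk_zero_combs (u i)).
move=> leQ.
pose comb (b : forall i, 'I_(nn i) -> S) (p : T) :=
  \sum_(j < nn (tag p)) iota (Q (tag p) j (tagged p)) * b (tag p) j.
pose Z := [set p | comb u p == 0].
pose lamN t := oapp lam 0 (insub t).
have lamNE (t : 'I_k) : lamN t = lam t by rewrite /lamN valK.
rewrite -lamNE; apply: (skew_roots (Z := Z) (b := comb beta)) (ltn_ord s).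
(* A relation [c] among the combined points, extended by zero to [c'], is the relation [Q i *m c']
   among the [beta i]; invertibility of [Q i] gives [c' = 0]. *)
- move=> i c; rewrite sum_block => sum0 [i' j0] pZ /= ei; subst i'.
  pose c' : 'cV[R]_(nn i) := \col_j if tg j \in Z then c (tg j) else 0.
  have Qc0 : Q i *m c' = 0.
    apply/colP => j'; rewrite [RHS]mxE.
    apply: (beta_indep (c := fun j' => (Q i *m c') j' 0)); rewrite -[RHS]sum0.
    under eq_bigr do rewrite mxE rmorph_sum mulr_suml.
    rewrite exchange_big [RHS]big_mkcond; apply: eq_bigr => j _ /=.
    rewrite mxE; case: ifP => _; last first.
      by apply: big1 => j1 _; rewrite mulr0 rmorph0 mul0r.
    rewrite /comb /= mulr_sumr; apply: eq_bigr => j1 _.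
    by rewrite rmorphM; ring.
  have c'0 : c' = 0 by rewrite -[c'](mulKmx (QP i)) Qc0 mulmx0.
  by have /colP/(_ j0) := c'0; rewrite !mxE pZ.
- rewrite card_idx_set -(leq_add2l (wtSR iota x m (encode lam))).
  rewrite (leq_trans _ (_ : ntot nn <= _)%N) //.
    by rewrite addnC -leq_subRL.
  rewrite /wtSR -big_split; apply: leq_sum => i _ /=.
  apply: leq_trans (leQ i) _; rewrite leq_add2l; apply: subset_leq_card.
  by apply/subsetP => j; rewrite !inE.
move=> p; rewrite inE => /eqP <-; rewrite /skew_eval /comb.
under eq_bigr do rewrite Dop_sum mulr_sumr.
rewrite exchange_big; apply: eq_bigr => j _ /=.
rewrite /u ffunE mulr_sumr; apply: eq_bigr => t _ /=.
rewrite lamNE DopM; have -> : iter t sigma (iota (Q (tag p) j (tagged p))) =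
    iota (Q (tag p) j (tagged p)) by elim: (t : nat) => //= t' ->.
by ring.
Qed.

Lemma encodeB (lam mu : 'I_k -> S) :
  [ffun p => encode lam p - encode mu p] = encode (fun s => lam s - mu s).
Proof.
by apply/ffunP => p; rewrite !ffunE -sumrB; apply: eq_bigr => s _; rewrite mulrBl.
Qed.

Lemma encode_eq0 (lam : 'I_k -> S) : encode lam = [ffun=> 0] -> forall s, lam s = 0.
Proof.
move=> e0 s; apply/eqP/negPn/negP => /encode_wt; rewrite addn1 ltnNge e0.
rewrite (leq_trans (wtSR_le_supp _)) //.
by rewrite (eq_card0 (A := [set _ | _])) // => p; rewrite !inE ffunE eqxx.
Qed.

Lemma encode_inj (lam mu : 'I_k -> S) : encode lam = encode mu -> lam =1 mu.
Proof.
move=> e s; apply/eqP; rewrite -subr_eq0; apply/eqP; move: s; apply: encode_eq0.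
by rewrite -encodeB e; apply/ffunP => p; rewrite !ffunE subrr.
Qed.

Lemma code_CkP c :
  reflect (exists lam : 'I_k -> S, c = encode lam) (c \in code_Ck sigma a beta k).
Proof.
rewrite inE; apply: (iffP existsP) => [[lam /eqP ->]|[lam ->]]; first by exists lam.
exists [ffun s => lam s]; apply/eqP/ffunP => p; rewrite !ffunE.
by apply: eq_bigr => s _; rewrite ffunE.
Qed.

Let encode_unit s p :
  encode (fun s' => (s' == s)%:R) p = Dop sigma (a (tag p)) s (beta (tag p) (tagged p)).
Proof.
rewrite ffunE (bigD1 s) //= eqxx mul1r big1 ?addr0 // => s' /negPf->.
by rewrite mul0r.
Qed.

Lemma code_Ck_free : free_of_rank (code_Ck sigma a beta k) k.
Proof.
(* The images of the unit vectors are the rows of the generator matrix. *)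
exists (fun s => encode (fun s' => (s' == s)%:R)); split; last split.
- by move=> s; apply/code_CkP; exists (fun s' => (s' == s)%:R).
- move=> _ /code_CkP[lam ->]; exists lam.
  apply/ffunP => p; rewrite [RHS]ffunE [LHS]ffunE; apply: eq_bigr => s _.
  by rewrite encode_unit.
move=> lam e0 s; apply: encode_eq0 => //; rewrite -e0.
apply/ffunP => p; rewrite [RHS]ffunE [LHS]ffunE; apply: eq_bigr => s' _.
by rewrite encode_unit.
Qed.

Lemma card_code_Ck : #|code_Ck sigma a beta k| = (#|[set: S]| ^ k)%N.
Proof.
have -> : code_Ck sigma a beta k = [set encode lam | lam : {ffun 'I_k -> S}].
  apply/setP => c; apply/code_CkP/imsetP => [[lam ->]|[lam _ ->]]; last by exists lam.
  exists [ffun s => lam s] => //; apply/ffunP => p; rewrite !ffunE.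
  by apply: eq_bigr => s _; rewrite ffunE.
rewrite card_imset ?card_ffun ?card_ord ?cardsT // => lam mu /encode_inj e.
exact/ffunP.
Qed.

(** Pigeonhole: restriction to k - 1 positions cannot separate |S|^k messages, so two codewords
    differ in at most n - k + 1 positions. *)
Lemma encode_low_weight : exists lam mu : {ffun 'I_k -> S},
  lam != mu /\ (wtSR iota x m (encode (fun s => (lam s - mu s)%R)) <= ntot nn - k + 1)%N.
Proof.
have lek1 : (k.-1 <= #|T|)%N by rewrite card_idx (leq_trans (leq_pred k)).
pose g (s : 'I_k.-1) : T := enum_val (widen_ord lek1 s).
have g_inj : injective g.
  by move=> s t /enum_val_inj /(congr1 val) /= e; apply: val_inj.
pose f (lam : {ffun 'I_k -> S}) := [ffun s => encode lam (g s)].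
have /injectivePn[lam [mu ne e]] : ~~ injectiveb f.
  apply/negP => /injectiveP /leq_card; rewrite !card_ffun !card_ord.
  rewrite leq_exp2l; first by rewrite -ltnS (ltn_predK k_gt0) ltnn.
  by apply/card_gt1P; exists 0, 1; rewrite ?inE // eq_sym oner_neq0.
exists lam, mu; split=> //; apply: leq_trans (wtSR_le_supp _) _.
set A := [set p | _]; have sub : A \subset ~: [set g s | s : 'I_k.-1].
  apply/subsetP => p; rewrite !inE; apply: contra => /imsetP[s _ ->].
  rewrite -encodeB ffunE subr_eq0; have := congr1 (fun c : {ffun _ -> S} => c s) e.
  by rewrite !ffunE => ->.
apply: leq_trans (subset_leq_card sub) _.
rewrite cardsCs setCK card_imset // card_ord card_idx addn1 -subSn //.
by rewrite -{2}(prednK k_gt0) subSS.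
Qed.

Lemma code_Ck_MSRD : is_MSRD iota x m (code_Ck sigma a beta k).
Proof.
exists k; split=> //; split; first exact: card_code_Ck.
apply/eqP; rewrite eqn_leq; apply/andP; split.
  have [lam [mu [ne le_wt]]] := encode_low_weight; apply: leq_trans le_wt.
  have inC (nu : {ffun 'I_k -> S}) : encode nu \in code_Ck sigma a beta k.
    by apply/code_CkP; exists nu.
  apply: leq_trans (bigminn_le _ _ (inC lam)) _.
  rewrite -encodeB; apply: (bigminn_le _ (dist_SR iota x m (encode lam))).
  rewrite inC; apply: contraNneq ne => /encode_inj e; exact/eqP/ffunP.
(* The minima in [dSR] default to [ntot nn], so the lower bound has to hold for this value too;
   [0 < k] ensures it. *)
have le_n : (ntot nn - k + 1 <= ntot nn)%N.
  by rewrite addn1 ltn_subrL k_gt0 (leq_trans k_gt0).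
apply: le_bigminn => // _ /code_CkP[lam ->].
apply: le_bigminn => // _ /andP[/code_CkP[mu ->] ne].
rewrite /dist_SR encodeB.
have /existsP[s nes] : [exists s, lam s - mu s != 0].
  apply: contraNT ne => /existsPn e; apply/eqP/ffunP => p; rewrite !ffunE.
  apply: eq_bigr => s _; congr (_ * _); apply/eqP.
  by rewrite -subr_eq0; apply/negPn/e.
exact: encode_wt nes.
Qed.

End Rank.

Theorem theorem5 (R S : finComUnitRingType) (h : {poly R}) (m : nat)
  (iota : {rmorphism R -> S}) (x : S) (sigma : {rmorphism S -> S})
  (l : nat) (nn : 'I_l -> nat) (a : 'I_l -> S)
  (beta : forall i : 'I_l, 'I_(nn i) -> S) (k : nat) :
  (* R is a finite commutative chain ring *)
  is_chain_ring R ->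
  (* h monic of degree m, irreducible modulo the maximal ideal *)
  h \is monic -> size h = m.+1 -> (0 < m)%N -> irreducible_mod_max h ->
  (* S = R[x]/(h): evaluation at x is onto with kernel (h) *)
  (forall s : S, exists p : {poly R}, s = (map_poly iota p).[x]) ->
  (forall p : {poly R}, (map_poly iota p).[x] = 0 <-> exists g, p = g * h) ->
  (* sigma: generator of Gal(S/R), fixed ring R, lifting the q-Frobenius *)
  bijective sigma ->
  (forall r, sigma (iota r) = iota r) ->
  (forall s, sigma s = s -> exists r, s = iota r) ->
  (forall tau : {rmorphism S -> S}, bijective tau ->
     (forall r, tau (iota r) = iota r) ->
     exists i : nat, tau =1 iter i (sigma : S -> S)) ->
  (forall y : S, sigma y - y ^+ residue_card R \notin GRing.unit) ->
  (* data of the code *)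
  (forall i, (0 < nn i)%N) ->
  (forall i, a i \is a GRing.unit) ->
  (forall i j : 'I_l, (i < j)%N -> forall b : S, b \is a GRing.unit ->
     a i - sigma b * a j * b^-1 \is a GRing.unit) ->
  (forall (i : 'I_l) (c : 'I_(nn i) -> R),
     \sum_(j < nn i) iota (c j) * beta i j = 0 -> forall j, c j = 0) ->
  (1 <= k <= ntot nn)%N ->
  free_of_rank (@code_Ck S sigma l nn a beta k) k /\
  is_MSRD iota x m (@code_Ck S sigma l nn a beta k).
Proof.
move=> chainR h_monic size_h m_gt0 h_irr onto ker _ sigma_iota sigma_fixed _ frob _.
move=> a_unit a_nonconj beta_indep /andP[k_gt0 k_le].
have [rho [rho0 rho_nonunit rho_dvd]] := chain_socle chainR.
have coords := ext_coords h_monic size_h onto ker.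
have coords_inj := ext_coords_inj h_monic size_h ker.
(* For [j < i], use the assumption at [b^-1] and multiply by [- (sigma b * b^-1)]. *)
have nonconj i j : i != j -> forall b, b \is a GRing.unit ->
    a i - sigma b * a j * b^-1 \is a GRing.unit.
  rewrite neq_ltn => /orP[lt_ij|lt_ji] b ub; first exact: a_nonconj.
  have usb : sigma b \is a GRing.unit by apply: rmorph_unit.
  have ubV : b^-1 \is a GRing.unit by rewrite unitrV.
  have := a_nonconj j i lt_ji _ ubV; rewrite invrK rmorphV // => unc.
  suff -> : a i - sigma b * a j * b^-1 =
      - (sigma b * (a j - (sigma b)^-1 * a i * b) * b^-1).
    by rewrite unitrN !unitrM usb unc unitrV.
  transitivity (sigma b * (sigma b)^-1 * a i * (b * b^-1) - sigma b * a j * b^-1).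
    by rewrite !divrr // mul1r mulr1.
  by set u := b^-1; set v := (sigma b)^-1; ring.
have roots (Z : {set idx nn}) (b : idx nn -> S) :=
  ext_skew_roots chainR h_monic size_h m_gt0 h_irr onto ker rho0 rho_nonunit rho_dvd
    sigma_iota sigma_fixed frob a_unit nonconj (tg := fun p : idx nn => tag p)
    (Z := Z) (beta := b) (k := k).
split.
  exact: (code_Ck_free chainR coords coords_inj sigma_iota roots beta_indep k_le).
exact: (code_Ck_MSRD chainR coords coords_inj sigma_iota roots beta_indep k_gt0 k_le).
Qed.
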